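(* For every integer $n\ge 0$, monotone partitions of $[n]=\{1,2,\ldots,n\}$ are in one-to-one correspondence with non-overlapping partitions of $[n]$. Hence $|\mathcal{M}_n|=B^*_n$, where $\mathcal{M}_n$ is the set of monotone partitions of $[n]$ and $B^*_n$ is the number of non-overlapping partitions of $[n]$.
   Context: A partition of a set is a family of pairwise disjoint non-empty subsets (blocks) whose union is the set. A partition is monotone if, when its non-singleton blocks $A_1,\ldots,A_k$ are ordered so that $\min A_i>\min A_{i+1}$ for all $i\in[k-1]$, one also has $\max A_i>\max A_{i+1}$ for all $i\in[k-1]$. Two blocks $A$ and $B$ of a partition overlap if $\min A<\min B<\max A<\max B$; a partition is non-overlapping if no pair of its blocks overlaps. *)

(* Defs.v *)
From mathcomp Require Import all_boot.

Set Implicit Arguments.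
Unset Strict Implicit.
Unset Printing Implicit Defensive.

(* The ground set {1, ..., n} is rendered by 'I_n = {0, ..., n-1}: everything
   below depends on the linear order of the ground set only. *)
Definition set_partitions (n : nat) : {set {set {set 'I_n}}} :=
  [set P | partition P [set: 'I_n]].

(* Only meaningful for A != set0: elements of 'I_n are < n, so the default
   value n is never the minimum of a nonempty A. *)
Definition bmin (n : nat) (A : {set 'I_n}) : nat :=
  \big[minn/n]_(i in A) (i : nat).

Definition bmax (n : nat) (A : {set 'I_n}) : nat :=
  \max_(i in A) (i : nat).

(* Distinct blocks of a partition are disjoint, so they have distinct minima
   and the sorted sequence has strictly decreasing minima. *)
Definition nonsingleton_blocks (n : nat) (P : {set {set 'I_n}}) :
    seq {set 'I_n} :=
  sort (fun A B => bmin B <= bmin A) (enum [set A in P | #|A| != 1]).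

Definition monotone (n : nat) (P : {set {set 'I_n}}) : bool :=
  sorted (fun A B => bmax B < bmax A) (nonsingleton_blocks P).

Definition overlap (n : nat) (A B : {set 'I_n}) : bool :=
  [&& bmin A < bmin B, bmin B < bmax A & bmax A < bmax B].

Definition nonoverlapping (n : nat) (P : {set {set 'I_n}}) : bool :=
  [forall A in P, forall B in P, ~~ overlap A B].

Definition monotone_partitions (n : nat) : {set {set {set 'I_n}}} :=
  [set P in set_partitions n | monotone P].

Definition nonoverlapping_partitions (n : nat) : {set {set {set 'I_n}}} :=
  [set P in set_partitions n | nonoverlapping P].

(* The Bessel number B*_n. *)
Definition bessel (n : nat) : nat := #|nonoverlapping_partitions n|.

(* Main.v *)
Require Import Defs.
From mathcomp Require Import all_boot.

Set Implicit Arguments.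
Unset Strict Implicit.
Unset Printing Implicit Defensive.

(** Read [n] from left to right and call a block pending while its minimum is
    past and some of its elements are still to come.  Name each block by its
    minimum; a partition then is the function sending an element to the label
    of its block ([min_label]).  A new element either starts a block (which
    becomes pending or is a singleton), or joins a pending block and keeps it
    pending, or is the last element of a pending block.

    A partition is monotone exactly when every last element of a non-singleton
    block closes the oldest pending block, the one with the least minimum
    (first in, first out): closing another one would nest it inside an older
    block ([monotone_served]).  It is non-overlapping exactly when every such
    element closes the newest pending block (last in, first out): closing
    another one would make it overlap a newer block
    ([nonoverlapping_served]).

    Under any such discipline, if h blocks are pending there are two ways to
    start a block, h ways to continue one, and a single way to close one when
    h > 0.  Hence the number of ways to finish depends on h and on the number
    of remaining elements, not on the discipline: it counts the Motzkin paths
    that go from height h to 0 with level steps at height h weighted by h + 1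
    ([card_completions]).  Both families are therefore counted by the same
    number, and a bijection follows. *)

(** * Label functions that obey a closing discipline *)

Section Queue.
Variable n : nat.
Implicit Types (f g : {ffun 'I_n -> 'I_n}) (S U : {set 'I_n}) (x y j : 'I_n).

(** With [f] the labelling by minima, the blocks that have an element before
    [m] and one at or after [m].  It depends only on the values of [f] from
    [m] on, so a labelling can be built from right to left. *)
Definition pending f (m : nat) : {set 'I_n} :=
  [set x : 'I_n | (x < m) && [exists k : 'I_n, (m <= k) && (f k == x)]].

Lemma pendingP f (m : nat) x :
  reflect (x < m /\ exists2 k : 'I_n, m <= k & f k = x) (x \in pending f m).
Proof.
rewrite inE; apply: (iffP andP) => [[xm /existsP[k /andP[mk /eqP fk]]]|].
  by split=> //; exists k.
by case=> xm [k mk fk]; split=> //; apply/existsP; exists k; rewrite mk fk eqxx.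
Qed.

Lemma eq_pending f g (m : nat) :
  (forall k : 'I_n, m <= k -> f k = g k) -> pending f m = pending g m.
Proof.
move=> fg; apply/setP=> x; rewrite !inE; congr (_ && _).
by apply: eq_existsb => k; case: leqP => //= /fg ->.
Qed.

Lemma pendingS f j :
  pending f j
  = pending f j.+1 :\ j :|: (if f j < j then [set f j] else set0).
Proof.
have -> : (if f j < j then [set f j] else set0)
    = [set x : 'I_n | (x < j) && (f j == x)].
  apply/setP=> x; rewrite [RHS]inE; case: (eqVneq (f j) x) => [<-|ne].
    by rewrite andbT; case: ifP; rewrite inE ?eqxx.
  by rewrite andbF; case: ifP; rewrite inE // eq_sym (negPf ne).
apply/setP=> x; apply/pendingP/idP=> [[xj [k]]|].
  rewrite !inE xj leq_eqVlt => /predU1P[/val_inj <- ->|jk fk].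
    by rewrite eqxx orbT.
  rewrite -val_eqE (ltn_eqF xj) ltnW //=; apply/orP; left.
  by apply/existsP; exists k; rewrite jk fk eqxx.
rewrite !inE => /orP[/and3P[xj]|/andP[xj /eqP fj]]; last first.
  by split=> //; exists j.
rewrite ltnS leq_eqVlt val_eqE (negPf xj) /= => ltxj.
case/existsP=> k /andP[/ltnW jk /eqP fk].
by split=> //; exists k.
Qed.

Definition first_in (p : 'I_n -> nat) S x : bool :=
  [forall y in S, p x <= p y].

(** A discipline is given by [p]: when [j] is the last element of a
    non-singleton block, the label of this block must have the least value of
    [p] among the pending labels.  The first two alternatives say that [j] is not such an
    element. *)
Definition served (p : 'I_n -> nat) f j : bool :=
  [|| f j == j, f j \in pending f j.+1 | first_in p (pending f j) (f j)].

(** The second condition makes [f] idempotent: a label that is used after [j]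
    and equals [j] must be the label of [j] itself. *)
Definition step (p : 'I_n -> nat) f j : bool :=
  [&& f j <= j, (j \in pending f j.+1) ==> (f j == j) & served p f j].

(** Below [m], where nothing is decided yet, [f] is frozen to the identity, so
    that the functions counted are determined by their values from [m] on. *)
Definition labels_from (p : 'I_n -> nat) (m : nat) f : bool :=
  [forall j : 'I_n, if j < m then f j == j else step p f j].

(** The ways to label the elements from [m] on when exactly the blocks in [S]
    are pending. *)
Definition completions (p : 'I_n -> nat) (m : nat) S :=
  [set f | labels_from p m f & pending f m == S].

(** Weighted count of the Motzkin paths of length [r] from height [h] to 0, a
    level step at height [h] having weight [h.+1]. *)
Fixpoint motzkin (r h : nat) : nat :=
  if r is r'.+1 then
    motzkin r' h.+1 + h.+1 * motzkin r' h + (0 < h) * motzkin r' h.-1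
  else h == 0.

Variable p : 'I_n -> nat.

(** What [step] at [j], with label [x] and pending set [S], demands of the
    labels after [j], for which [U] is the pending set. *)
Definition prepends j S x U : bool :=
  [&& x <= j, (j \in U) ==> (x == j),
      [|| x == j, x \in U | first_in p S x] &
      U :\ j :|: (if x < j then [set x] else set0) == S].

(** Resetting the label of [j] to the frozen value [j] loses nothing, as this
    label is known to be [x], and the conditions at elements after [j] do not
    look at it. *)
Lemma card_first_label j S x :
  #|[set f in completions p j S | f j == x]|
  = #|[set g | labels_from p j.+1 g & prepends j S x (pending g j.+1)]|.
Proof.
pose ext g : {ffun 'I_n -> 'I_n} := [ffun k => if k == j then x else g k].
have ext_j g : ext g j = x by rewrite ffunE eqxx.
have ext_gt g (k : 'I_n) : j < k -> ext g k = g k.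
  by move=> jk; rewrite ffunE -val_eqE gtn_eqF.
have eq_ext (f g : {ffun 'I_n -> 'I_n}) :
    (forall k : 'I_n, j < k -> f k = g k) -> f j = x ->
    labels_from p j.+1 g -> (forall k : 'I_n, k < j -> f k = k) ->
    prepends j S x (pending g j.+1) = (f \in completions p j S).
  move=> fg fj /forallP gP flt.
  have pd (m : nat) : j < m -> pending f m = pending g m.
    by move=> jm; apply: eq_pending => k mk; apply: fg; apply: leq_trans mk.
  have pj := pendingS f j; rewrite (pd j.+1) // fj in pj.
  rewrite /prepends -pj [RHS]inE.
  have -> : labels_from p j f = step p f j.
    apply/forallP/idP=> [/(_ j)|stj k]; first by rewrite ltnn.
    case: ltngtP => [kj|jk|/val_inj -> //]; first by rewrite flt.
    have := gP k; rewrite ltnS leqNgt jk /= /step /served fg //.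
    by rewrite (pd k) // (pd k.+1) // ltnW.
  rewrite /step /served fj (pd j.+1) //.
  case: (pending f j =P S) => [->|_]; last by rewrite !andbF.
  by rewrite !andbT.
rewrite -[RHS](@card_in_imset _ _ ext) => [|g h]; last first.
  rewrite !inE => /andP[/forallP gP _] /andP[/forallP hP _].
  have := hP j; have := gP j; rewrite ltnSn => /eqP gj /eqP hj /ffunP e.
  apply/ffunP=> k.
  by have := e k; rewrite !ffunE; case: eqP => // ->; rewrite gj hj.
congr #|pred_of_set _|; apply/setP=> f; rewrite inE.
apply/andP/imsetP=> [[fC /eqP fj]|[g]].
  pose g : {ffun 'I_n -> 'I_n} := [ffun k => if k == j then j else f k].
  have fg (k : 'I_n) : j < k -> f k = g k.
    by move=> jk; rewrite ffunE -val_eqE gtn_eqF.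
  have fE : f = ext g.
    by apply/ffunP=> k; rewrite !ffunE; case: eqP => // ->.
  have /forallP fP : labels_from p j f by move: fC; rewrite inE => /andP[].
  have gP : labels_from p j.+1 g.
    apply/forallP=> k; have := fP k; rewrite ltnS.
    case: ltngtP => [kj|jk|/val_inj -> _].
    - by move=> fk; rewrite ffunE; case: (k =P j) => // ->.
    - have pd (m : nat) : j < m -> pending f m = pending g m.
        by move=> jm; apply: eq_pending => i mi; apply/fg/(leq_trans jm mi).
      by rewrite /step /served fg // (pd k) // (pd k.+1) // ltnW.
    - by rewrite ffunE eqxx.
  exists g => //; rewrite inE gP (eq_ext f) // => k kj.
  by have := fP k; rewrite kj => /eqP.
rewrite inE => /andP[gP gS] ->; split; last by rewrite ext_j.
rewrite -(eq_ext _ g (ext_gt g)) // => k kj.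
have /forallP/(_ k) := gP; rewrite ltnS (ltnW kj) => /eqP gk.
by rewrite ffunE -val_eqE ltn_eqF.
Qed.

(** An element that starts a block is a singleton or leaves its block
    pending. *)
Lemma prepends_first j S U : j \notin S ->
  prepends j S j U = (U == S) || (U == j |: S).
Proof.
move=> jS; rewrite /prepends leqnn eqxx implybT ltnn setU0 /=.
have [jU|jU] := boolP (j \in U).
  have -> : U == S = false by apply: contraNF jS => /eqP <-.
  apply/eqP/eqP=> [<-|->]; first by rewrite setD1K.
  by rewrite setU1K.
have -> : U == j |: S = false by apply: contraNF jU => /eqP ->; rewrite setU11.
rewrite orbF; congr (_ == _).
by apply/setDidPl; rewrite disjoint_sym disjoints1.
Qed.

(** An element that joins an old block leaves it pending, or closes it if it
    comes first in the discipline. *)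
Lemma prepends_old j S x U : j \notin S -> (forall y, y \in S -> y < j) ->
  x != j ->
  prepends j S x U
  = (x \in S) && ((U == S) || first_in p S x && (U == S :\ x)).
Proof.
move=> jS Slt xj; rewrite /prepends (negPf xj) /=.
have [xS|xS] := boolP (x \in S); last first.
  apply: contraNF xS => /and4P[xlej _ _ /eqP <-].
  by rewrite ltn_neqAle xlej val_eqE xj !inE eqxx orbT.
have xlt := Slt x xS; rewrite (ltnW xlt) xlt /= implybF.
have [jU|jU] /= := boolP (j \in U).
  apply/esym/negbTE/negP=> /orP[/eqP e|/andP[_ /eqP e]].
    by rewrite e (negPf jS) in jU.
  by rewrite e !inE (negPf jS) andbF in jU.
have -> : U :\ j = U.
  by apply/setDidPl; rewrite disjoint_sym disjoints1.
have [xU|xU] /= := boolP (x \in U).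
  have -> : U :|: [set x] = U by apply/setUidPl; rewrite sub1set.
  suff -> : U == S :\ x = false by rewrite andbF orbF.
  by apply: contraTF xU => /eqP ->; rewrite setD11.
have -> : U == S = false by apply: contraNF xU => /eqP ->.
congr (_ && _); apply/eqP/eqP=> [<-|->]; last by rewrite setUC setD1K.
by rewrite setUC setU1K.
Qed.

Lemma card_labels_from2 (m : nat) U1 U2 (b : bool) : U1 != U2 ->
  #|[set g | labels_from p m g &
       (pending g m == U1) || b && (pending g m == U2)]|
  = #|completions p m U1| + b * #|completions p m U2|.
Proof.
move=> U12; case: b => /=; rewrite ?mul1n ?addn0; last first.
  by apply: eq_card => g; rewrite !inE orbF.
rewrite -cardsUI [X in _ = _ + #|pred_of_set X|](_ : _ = set0).
  by rewrite cards0 addn0; apply: eq_card => g; rewrite !inE andb_orr.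
apply/setP=> g; rewrite !inE; apply/negP=> /andP[/andP[_ /eqP ->]] /andP[_].
by rewrite (negPf U12).
Qed.

Hypothesis p_inj : injective p.

(** The only point where the discipline enters the count: injectivity of [p]
    makes it single out one block of every nonempty pending set. *)
Lemma card_first_in S : \sum_(x in S) first_in p S x = (0 < #|S|).
Proof.
have [->|[x0 x0S]] := set_0Vmem S; first by rewrite big_set0 cards0.
rewrite (cardD1 x0) x0S; case: (arg_minnP p x0S) => x xS xmin.
rewrite (bigD1 x) //= big1 => [|y /andP[yS yx]].
  by rewrite addn0; apply/eqP; rewrite eqb1; apply/forall_inP.
apply/eqP; rewrite eqb0; apply: contra yx => /forall_inP/(_ x xS) yx.
by apply/eqP/p_inj/eqP; rewrite eqn_leq yx xmin.
Qed.

(** Classify the completions by the label of their first element [m]: the label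
    [m] gives the terms for a new block, a label in [S] those for an old one. *)
Lemma card_completions (r m : nat) S : m + r = n ->
  (forall x, x \in S -> x < m) -> #|completions p m S| = motzkin r #|S|.
Proof.
elim: r m S => [|r IHr] m S mr Slt /=.
  have pd0 f : pending f m = set0.
    apply/setP=> x; rewrite [RHS]inE; apply/negP=> /pendingP[_ [k]].
    by rewrite leqNgt -[m]addn0 mr ltn_ord.
  rewrite cards_eq0; have [->|S0] := altP (S =P set0); last first.
    apply: eq_card0 => f; rewrite inE pd0 eq_sym (negPf S0) andbF.
    by [].
  rewrite (@eq_card1 _ [ffun j => j]) // => f; rewrite inE pd0 eqxx andbT.
  apply/forallP/eqP=> [fE|-> j]; last by rewrite -[m]addn0 mr ltn_ord ffunE.
  apply/ffunP=> j; rewrite ffunE.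
  by have := fE j; rewrite -[m]addn0 mr ltn_ord => /eqP.
have mn : m < n by rewrite -mr addnS ltnS leq_addr.
pose j := Ordinal mn; have jE : j = m :> nat by [].
have jS : j \notin S by apply/negP=> /Slt; rewrite jE ltnn.
have {}IHr U : (forall x, x \in U -> x <= m) ->
    #|completions p m.+1 U| = motzkin r #|U|.
  by move=> Ult; apply: IHr => //; rewrite addSnnS.
rewrite -sum1_card (partition_big (fun f : {ffun _} => f j) predT) //=.
have first_label x :
    \sum_(f in completions p m S | f j == x) 1
    = #|[set g | labels_from p m.+1 g & prepends j S x (pending g m.+1)]|.
  by rewrite -(card_first_label j) -sum1_card; apply: eq_bigl => f; rewrite inE.
rewrite (eq_bigr _ (fun x _ => first_label x)).
rewrite (bigD1 j) //=.
have -> : #|[set g | labels_from p m.+1 g & prepends j S j (pending g m.+1)]|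
    = motzkin r #|S| + motzkin r #|S|.+1.
  under eq_finset => g do
    rewrite (prepends_first _ jS) -[pending g _ == _ |: _]andTb.
  rewrite card_labels_from2; last first.
    by apply: contraNneq jS => ->; rewrite setU11.
  rewrite (IHr S) => [|x /Slt/ltnW] //; rewrite IHr ?mul1n ?cardsU1 ?jS // => x.
  by rewrite !inE => /predU1P[->|/Slt/ltnW].
rewrite (bigID (mem S)) /= [X in _ + (_ + X)]big1 ?addn0; last first.
  move=> x /andP[xj xS]; apply: eq_card0 => g.
  by rewrite inE prepends_old // (negPf xS) andbF.
have -> : \sum_(x | (x != j) && (x \in S))
    #|[set g | labels_from p m.+1 g & prepends j S x (pending g m.+1)]|
  = \sum_(x in S) (motzkin r #|S| + first_in p S x * motzkin r #|S|.-1).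
  apply: eq_big => [x|x /andP[xj xS]].
    by case: (x =P j) => // ->; rewrite (negPf jS).
  under eq_finset => g do rewrite prepends_old // xS andTb.
  rewrite card_labels_from2; last first.
    by apply: contraTneq xS => ->; rewrite setD11.
  rewrite !IHr => [|y /setD1P[_ /Slt/ltnW]|y /Slt/ltnW] //.
  by rewrite (cardsD1 x S) xS add1n.
rewrite big_split /= sum_nat_const -big_distrl /= card_first_in.
by rewrite addnA mulSn; congr (_ + _); rewrite addnAC addnC.
Qed.

End Queue.

(** * Partitions as label functions *)

Section Partitions.
Variable n : nat.
Implicit Types (P : {set {set 'I_n}}) (A B : {set 'I_n}) (i j k x y : 'I_n).

Lemma leq_bmax A i : i \in A -> i <= bmax A.
Proof.
by move=> iA; apply: (@leq_bigmax_cond _ _ (fun k : 'I_n => k : nat) i iA).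
Qed.

Lemma bmax_mem A i : i \in A -> exists2 c, c \in A & bmax A = c.
Proof.
move=> iA; have A0 : 0 < #|A| by apply/card_gt0P; exists i.
by have [c cA e] := eq_bigmax_cond (fun i : 'I_n => i : nat) A0; exists c.
Qed.

Lemma bmin_eq A i : i \in A -> (forall k, k \in A -> i <= k) -> bmin A = i.
Proof.
move=> iA imin; apply/eqP; rewrite eqn_leq; apply/andP; split.
  rewrite /bmin; move: (mem_index_enum i); elim: (index_enum _) => // k s IHs.
  rewrite inE big_cons => /predU1P[<-|/IHs]; first by rewrite iA geq_minl.
  by case: ifP => // _; apply: leq_trans; apply: geq_minr.
rewrite /bmin; elim/big_ind: _ => [|a b ia ib|k /imin //]; first exact: ltnW.
by rewrite leq_min ia ib.
Qed.

Definition min_label P : {ffun 'I_n -> 'I_n} :=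
  [ffun i => [arg min_(k < i in pblock P i) (k : nat)]].

Section OnePartition.
Variable P : {set {set 'I_n}}.
Hypothesis partP : partition P [set: 'I_n].
Let f := min_label P.

Let trivP : trivIset P. Proof. by case/and3P: partP. Qed.
Let covP i : i \in cover P.
Proof. by case/and3P: partP => /eqP-> _ _; rewrite inE. Qed.

Lemma min_labelP i :
  f i \in pblock P i /\ forall k, k \in pblock P i -> f i <= k.
Proof. by rewrite ffunE; case: arg_minnP; rewrite ?mem_pblock. Qed.

Lemma eq_min_label i k : (f i == f k) = (k \in pblock P i).
Proof.
have [fi imin] := min_labelP i; have [fk kmin] := min_labelP k.
apply/eqP/idP=> [fik|ki].
  rewrite -(same_pblock trivP fi) fik (same_pblock trivP fk).
  by rewrite mem_pblock.
have ePk := same_pblock trivP ki.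
by apply/val_inj/eqP; rewrite eqn_leq imin -?ePk // kmin // ePk.
Qed.

Lemma min_label_leq i : f i <= i.
Proof. by apply (min_labelP i).2; rewrite mem_pblock. Qed.

Lemma min_label_idem i : f (f i) = f i.
Proof. by apply/esym/eqP; rewrite eq_min_label (min_labelP i).1. Qed.

Lemma blockP A : A \in P -> exists i, A = pblock P i.
Proof.
move=> AP; have [A0|[i iA]] := set_0Vmem A.
  by case/and3P: partP => _ _ /negP[]; rewrite -A0.
by exists i; rewrite (def_pblock trivP AP iA).
Qed.

Lemma bmin_pblock i : bmin (pblock P i) = f i.
Proof. by have [] := min_labelP i; apply: bmin_eq. Qed.

Lemma bmax_pblock i : exists2 c, f c = f i & bmax (pblock P i) = c.
Proof.
have [fi _] := min_labelP i; have [c ci e] := bmax_mem fi.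
by exists c => //; apply/esym/eqP; rewrite eq_min_label.
Qed.

Lemma leq_bmax_pblock i k : f k = f i -> k <= bmax (pblock P i).
Proof. by move=> fk; apply: leq_bmax; rewrite -eq_min_label fk. Qed.

Lemma pblock_in i : pblock P i \in P.
Proof. exact: pblock_mem. Qed.

Lemma singleton_pblock i k :
  f k = f i -> f k != k -> #|pblock P i| != 1.
Proof.
move=> fk; apply: contraNneq => /eqP/cards1P[a e].
have : k \in pblock P i by rewrite -eq_min_label fk.
have := (min_labelP i).1.
by rewrite fk e !inE => /eqP-> /eqP->.
Qed.

(** Together with [bmax_nonsingleton], this says that the maximum of a
    non-singleton block falls under the third alternative of [served]. *)
Lemma bmax_closer c i :
  f c = f i -> bmax (pblock P i) = c -> f c \notin pending f c.+1.
Proof.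
move=> fc e; apply/negP=> /pendingP[_ [k ck fk]].
by move: ck; rewrite ltnNge -e leq_bmax_pblock // fk.
Qed.

Lemma bmax_nonsingleton c i :
  #|pblock P i| != 1 -> f c = f i -> bmax (pblock P i) = c -> f c != c.
Proof.
move=> i1 fc e; apply: contraNneq i1 => fcc; apply/cards1P; exists c.
apply/setP=> x; rewrite inE -eq_min_label -fc; apply/eqP/eqP=> [fx|->] //.
have xc : x <= c by rewrite -e leq_bmax_pblock // -fx.
have cx : c <= x by rewrite -fcc fx min_label_leq.
by apply/ord_inj/eqP; rewrite eqn_leq xc.
Qed.

(** Sorting is used only through the order of the minima: these are distinct on
    blocks, so the sorted sequence is strictly sorted by them. *)
Lemma monotoneP :
  reflect (forall i k, #|pblock P i| != 1 -> #|pblock P k| != 1 ->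
             f i < f k -> bmax (pblock P i) < bmax (pblock P k))
          (monotone P).
Proof.
rewrite /monotone /nonsingleton_blocks.
set e := fun A B => bmin B <= bmin A.
set s := enum _.
have e_tr : transitive e by move=> ? ? ? h1 h2; apply: leq_trans h1.
have e_tot : total e by move=> A B; apply: leq_total.
have memS i : #|pblock P i| != 1 -> pblock P i \in sort e s.
  by move=> i1; rewrite mem_sort mem_enum inE pblock_in.
have sE A : A \in sort e s -> exists2 i, A = pblock P i & #|A| != 1.
  rewrite mem_sort mem_enum inE => /andP[/blockP[i ->] i1].
  by exists i.
have e_s : sorted e (sort e s) by apply: sort_sorted.
apply: (iffP idP) => [r_s i k i1 k1 ik|mono].
  have r_tr : transitive (fun A B => bmax B < bmax A).
    by move=> ? ? ? h1 h2; apply: ltn_trans h1.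
  apply: (sorted_ltn_index r_tr r_s); try exact: memS.
  rewrite ltnNge; apply: contraL ik => ik; rewrite -leqNgt -!bmin_pblock.
  have e_refl : reflexive e by move=> A; apply: leqnn.
  exact: (sorted_leq_index e_tr e_refl e_s _ _ (memS _ i1) (memS _ k1) ik).
(* Distinctness of the minima turns the weak sorting into a strict one. *)
have : sorted gtn (map (@bmin n) (sort e s)).
  rewrite gtn_sorted_uniq_geq sorted_map e_s andbT map_inj_in_uniq.
    by rewrite sort_uniq enum_uniq.
  move=> _ _ /sE[i -> _] /sE[k -> _]; rewrite !bmin_pblock => /val_inj/eqP.
  by rewrite eq_min_label => /(same_pblock trivP).
rewrite sorted_map; apply: (@sub_in_sorted _ (mem (sort e s))); last first.
  exact/allP.
move=> _ _ /sE[i -> i1] /sE[k -> k1] /=; rewrite !bmin_pblock; exact: mono.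
Qed.

Lemma nonoverlappingP :
  reflect (forall i k, f i < f k -> f k < bmax (pblock P i) ->
             bmax (pblock P k) <= bmax (pblock P i))
          (nonoverlapping P).
Proof.
apply: (iffP forall_inP) => [no i k ik ki|no A /blockP[i ->]].
  have := no _ (pblock_in i) => /forall_inP/(_ _ (pblock_in k)).
  by rewrite /overlap !bmin_pblock ik ki -leqNgt.
apply/forall_inP=> _ /blockP[k ->]; rewrite /overlap !bmin_pblock.
by apply/and3P=> -[ik ki]; rewrite ltnNge no.
Qed.

(** If some pending block is older than the block closed at [j], it reaches
    beyond [j] and so contains the latter between its extremes; conversely,
    where a block is nested in another, the outer one is pending and older when
    the inner one closes. *)
Lemma monotone_served :
  monotone P = [forall j, served (fun x => x) f j].
Proof.
apply/monotoneP/forallP=> [mono j|sv i k i1 k1 ik].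
  apply/or3P; case: (altP (f j =P j)) => [_|fj]; first by constructor.
  case: (boolP (f j \in pending f j.+1)) => [_|Nj]; first by constructor.
  constructor; apply/forall_inP=> y /pendingP[yj [k jk fk]].
  subst y.
  rewrite leqNgt; apply/negP=> kj.
  have fkk : f k != k by rewrite -val_eqE ltn_eqF // (leq_trans yj).
  have := mono k j (singleton_pblock erefl fkk) (singleton_pblock erefl fj) kj.
  have [c fc ->] := bmax_pblock j => kc.
  case/negP: Nj; apply/pendingP; rewrite ltnS min_label_leq; split=> //.
  exists c => //; apply: leq_ltn_trans kc.
  exact: leq_trans jk (leq_bmax_pblock _).
rewrite ltnNge; apply/negP=> ki.
have [c fc ec] := bmax_pblock k.
have [a fa ea] := bmax_pblock i; rewrite ec ea in ki.
have := sv c; rewrite /served (negPf (bmax_closer fc ec)) fc.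
rewrite -{1}fc (negPf (bmax_nonsingleton k1 fc ec)) /=.
have fi_pending : f i \in pending f c.
  apply/pendingP; split; last by exists a.
  by apply: leq_trans ik _; rewrite -fc min_label_leq.
by move/forall_inP/(_ _ fi_pending); rewrite leqNgt ik.
Qed.

(** The function [n - x] puts the newest block first.  If some pending block is
    newer than the block closed at [j], the two overlap; conversely, where [A]
    overlaps [B], the block [B] is pending and newer when [A] closes. *)
Lemma nonoverlapping_served :
  nonoverlapping P = [forall j, served (fun x => n - x) f j].
Proof.
apply/nonoverlappingP/forallP=> [no j|sv i k ik ki].
  apply/or3P; case: (altP (f j =P j)) => [_|fj]; first by constructor.
  case: (boolP (f j \in pending f j.+1)) => [_|Nj]; first by constructor.
  constructor; apply/forall_inP=> y /pendingP[yj [k jk fk]].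
  subst y.
  apply: leq_sub2l; rewrite leqNgt; apply/negP=> kj.
  have jmax : bmax (pblock P j) = j.
    have [c fc e] := bmax_pblock j.
    rewrite e; apply/eqP; rewrite eqn_leq -{2}e leq_bmax_pblock // andbT leqNgt.
    apply: contra Nj => jc; apply/pendingP.
    by rewrite ltnS min_label_leq; split=> //; exists c.
  have := no j k kj; rewrite jmax yj => /(_ isT) kle.
  have kj' := leq_trans (leq_bmax_pblock (erefl (f k))) kle.
  have jk' : k = j by apply/val_inj/eqP; rewrite eqn_leq kj' jk.
  by rewrite jk' ltnn in kj.
have [c fc ec] := bmax_pblock i.
have [b fb eb] := bmax_pblock k; rewrite ec eb in ki *.
rewrite leqNgt; apply/negP=> cb.
have := sv c; rewrite /served (negPf (bmax_closer fc ec)) fc.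
case: eqP => [fic|_] /=; first by rewrite -fic ltnNge ltnW in ki.
have fk_pending : f k \in pending f c.
  by apply/pendingP; split=> //; exists b => //; apply: ltnW.
by move/forall_inP/(_ _ fk_pending); rewrite leqNgt (ltn_sub2l _ ik) ?ltn_ord.
Qed.

End OnePartition.

Lemma min_labelK P : partition P [set: 'I_n] ->
  preim_partition (min_label P) [set: 'I_n] = P.
Proof.
move=> partP; rewrite -[RHS](preim_partition_pblock partP).
have trivP : trivIset P by case/and3P: partP.
apply: eq_imset => i; apply/setP=> k.
by rewrite !inE (eq_min_label partP) eq_pblock // (cover_partition partP) inE.
Qed.

Lemma min_label_preim (f : {ffun 'I_n -> 'I_n}) :
  (forall i, f i <= i) -> (forall i, f (f i) = f i) ->
  min_label (preim_partition f [set: 'I_n]) = f.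
Proof.
move=> f_le f_idem; set P := preim_partition _ _.
have partP : partition P [set: 'I_n] by apply: preim_partitionP.
have inP i k : (k \in pblock P i) = (f i == f k).
  by rewrite pblock_equivalence_partition ?inE // => x y z _ _ _;
    split=> // /eqP ->.
apply/ffunP=> i; have [mi i_min] := min_labelP partP i.
apply/ord_inj/eqP; rewrite eqn_leq i_min ?inP ?f_idem //=.
by move: mi; rewrite inP => /eqP->.
Qed.

(** With nothing before the first element, the completions are exactly the
    labellings of partitions by minima that obey the discipline. *)
Lemma completions0P (p : 'I_n -> nat) (f : {ffun 'I_n -> 'I_n}) :
  reflect [/\ forall i, f i <= i, forall i, f (f i) = f i
            & [forall j, served p f j]]
          (f \in completions p 0 set0).
Proof.
have pd0 : pending f 0 = set0 by apply/setP=> x; rewrite !inE.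
rewrite inE pd0 eqxx andbT.
apply: (iffP forallP) => [fP|[f_le f_idem /forallP sv] j].
  have f_le i : f i <= i by have /and3P[] := fP i.
  split=> // [i|]; last by apply/forallP=> i; have /and3P[] := fP i.
  have /and3P[_ /implyP pd _] := fP (f i).
  have := f_le i; rewrite leq_eqVlt => /predU1P[/ord_inj e|fi].
    by rewrite !e.
  by apply/eqP; apply: pd; apply/pendingP; split; [exact: leqnn | exists i].
rewrite /= /step f_le sv andbT /=; apply/implyP=> /pendingP[_ [k _ <-]].
by rewrite f_idem.
Qed.

Lemma card_served (p : 'I_n -> nat) (Q : pred {set {set 'I_n}}) :
  injective p ->
  (forall P, partition P [set: 'I_n] ->
     Q P = [forall j, served p (min_label P) j]) ->
  #|[set P in set_partitions n | Q P]| = motzkin n 0.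
Proof.
move=> p_inj QE; rewrite -[in RHS](cards0 'I_n).
rewrite -(@card_completions n p p_inj n 0) // => [|x]; last by rewrite inE.
rewrite -[LHS](@card_in_imset _ _ min_label) => [|P1 P2]; last first.
  rewrite !inE => /andP[part1 _] /andP[part2 _] e.
  by rewrite -(min_labelK part1) e min_labelK.
congr #|pred_of_set _|; apply/setP=> f; apply/imsetP/completions0P.
  case=> P; rewrite !inE => /andP[partP QP] ->; split=> [i|i|].
  - exact: min_label_leq.
  - exact: min_label_idem.
  - by rewrite -QE.
case=> f_le f_idem sv; have fE := min_label_preim f_le f_idem.
exists (preim_partition f [set: 'I_n]); last by rewrite fE.
have partP := preim_partitionP f [set: 'I_n].
by rewrite !inE partP QE // fE.
Qed.

End Partitions.

(** * The bijection *)

Lemma eq_card_bijective (T : finType) (A B : {set T}) :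
  #|A| = #|B| -> exists f : {x | x \in A} -> {x | x \in B}, bijective f.
Proof.
move=> AB.
have e : #|{: {x | x \in A}}| = #|{: {x | x \in B}}| by rewrite !card_sig.
exists (enum_val \o cast_ord e \o enum_rank).
apply: bij_comp; last exact: enum_rank_bij.
apply: bij_comp; first exact: enum_val_bij.
by exists (cast_ord (esym e)) => i; rewrite ?cast_ordK ?cast_ordKV.
Qed.

Theorem proposition16 (n : nat) :
  (exists f : {P : {set {set 'I_n}} | P \in monotone_partitions n} ->
              {P : {set {set 'I_n}} | P \in nonoverlapping_partitions n},
     bijective f)
  /\ #|monotone_partitions n| = bessel n.
Proof.
have eq_card : #|monotone_partitions n| = bessel n.
  have rev_inj : injective (fun x : 'I_n => n - x).
    move=> x y /= e; apply/ord_inj.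
    by rewrite -(subKn (ltnW (ltn_ord x))) e subKn // ltnW.
  rewrite /monotone_partitions (card_served (@ord_inj n) (@monotone_served n)).
  rewrite /bessel /nonoverlapping_partitions.
  by rewrite (card_served rev_inj (@nonoverlapping_served n)).
by split; first exact: eq_card_bijective.
Qed.
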